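(* For every integer $n\ge 28$ and every integer $k\ge 1$, $$3k+\lfloor k/2\rfloor\le \pi(P_n[K_k])\le 4k .$$
   Context: $P_n$ is the path on $n$ vertices and $K_k$ is the complete graph on $k$ vertices. The lexicographic product $G[H]$ of graphs $G=(V_1,E_1)$ and $H=(V_2,E_2)$ has vertex set $V_1\times V_2$, and $(v_1,v_2)$ is joined to $(v_1',v_2')$ if either $(v_1,v_1')\in E_1$, or $v_1=v_1'$ and $(v_2,v_2')\in E_2$. A sequence $x_1\ldots x_{2l}$ ($l\ge 1$) is a repetition if $x_i=x_{l+i}$ for all $1\le i\le l$. A vertex coloring $c$ of a graph $G$ is nonrepetitive if there is no path $v_1,\ldots,v_{2l}$ in $G$ (with distinct vertices, $l\ge1$) such that $c(v_1),\ldots,c(v_{2l})$ is a repetition. The Thue chromatic number $\pi(G)$ is the least number of colors in a nonrepetitive coloring of $G$. *)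

(* Defs.v *)
From mathcomp Require Import all_boot.
From mathcomp Require Import boolp.

Set Implicit Arguments.
Unset Strict Implicit.
Unset Printing Implicit Defensive.

(* A finite simple graph is represented by its adjacency relation e : rel V on
   the finType V of vertices; the graphs below are symmetric and irreflexive. *)

Definition path_graph (n : nat) : rel 'I_n :=
  [rel i j : 'I_n | (i.+1 == j :> nat) || (j.+1 == i :> nat)].

Definition complete_graph (k : nat) : rel 'I_k := [rel i j : 'I_k | i != j].

Definition lex_product (V1 V2 : finType) (e1 : rel V1) (e2 : rel V2) :
    rel (V1 * V2) :=
  [rel u v | e1 u.1 v.1 || (u.1 == v.1) && e2 u.2 v.2].

Lemma path_graph_sym n : symmetric (@path_graph n).
Proof. by move=> i j; rewrite /path_graph /= orbC. Qed.

Lemma path_graph_irr n : irreflexive (@path_graph n).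
Proof. by move=> i; rewrite /path_graph /= orbb gtn_eqF. Qed.

Lemma complete_graph_sym k : symmetric (@complete_graph k).
Proof. by move=> i j; rewrite /complete_graph /= eq_sym. Qed.

Lemma complete_graph_irr k : irreflexive (@complete_graph k).
Proof. by move=> i; rewrite /complete_graph /= eqxx. Qed.

Lemma lex_product_sym (V1 V2 : finType) (e1 : rel V1) (e2 : rel V2) :
  symmetric e1 -> symmetric e2 -> symmetric (lex_product e1 e2).
Proof. by move=> s1 s2 u v; rewrite /lex_product /= s1 s2 eq_sym. Qed.

Lemma lex_product_irr (V1 V2 : finType) (e1 : rel V1) (e2 : rel V2) :
  irreflexive e1 -> irreflexive e2 -> irreflexive (lex_product e1 e2).
Proof. by move=> i1 i2 u; rewrite /lex_product /= i1 i2 andbF. Qed.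

(* For i < l, both [onth] are [Some _] since size x = l.*2. *)
Definition repetition (C : Type) (x : seq C) : Prop :=
  exists l : nat, [/\ 0 < l, size x = l.*2 &
    forall i, i < l -> onth x i = onth x (l + i)].

Definition is_path (V : finType) (e : rel V) (p : seq V) : bool :=
  sorted e p && uniq p.

Definition nonrepetitive (V : finType) (e : rel V) (C : Type) (c : V -> C) :
    Prop :=
  forall p : seq V, is_path e p -> ~ repetition (map c p).

Definition nonrep_colorable (V : finType) (e : rel V) (m : nat) : Prop :=
  exists c : V -> 'I_m, nonrepetitive e c.

Lemma nonrepetitive_inj (V : finType) (e : rel V) (C : Type) (c : V -> C) :
  injective c -> nonrepetitive e c.
Proof.
move=> c_inj p /andP[_ up] [l [l_gt0]]; rewrite size_map => szp rep.
have lt_l : l < size p by rewrite szp -addnn -{1}[l]addn0 ltn_add2l.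
have [x px] : exists x, onth p 0 = Some x.
  by case: p lt_l {up szp rep} => // x p _; exists x.
have := rep 0 l_gt0; rewrite addn0 onth_map px => /esym /(inj_onth_map c_inj).
move=> /(onth_nth x) nl; move: px => /(onth_nth x) p0.
have := nth_uniq x (ltn_trans l_gt0 lt_l) lt_l up.
by rewrite p0 nl eqxx eq_sym gtn_eqF.
Qed.

Lemma ex_nonrep_colorable (V : finType) (e : rel V) :
  exists m, `[< nonrep_colorable e m >].
Proof.
exists #|V|; apply/asboolP; exists (@enum_rank V).
exact/nonrepetitive_inj/enum_rank_inj.
Qed.

Definition thue_chromatic (V : finType) (e : rel V) : nat :=
  ex_minn (ex_nonrep_colorable e).

Lemma thue_chromatic_colorable (V : finType) (e : rel V) :
  nonrep_colorable e (thue_chromatic e).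
Proof. by rewrite /thue_chromatic; case: ex_minnP => m /asboolP. Qed.

Lemma thue_chromatic_min (V : finType) (e : rel V) (m : nat) :
  nonrep_colorable e m -> thue_chromatic e <= m.
Proof.
by move=> /asboolP cm; rewrite /thue_chromatic; case: ex_minnP => ? _; apply.
Qed.

(* Main.v *)
Require Import Defs.
From mathcomp Require Import all_boot zify.

(** ** Why the bounds hold

    Upper bound.  Some square-free word [quaternary] over four letters has no
    factor of the form aba: take a square-free word over three letters, obtained
    from the Thue-Morse word, and insert a fourth letter after every second one.
    Colour vertex [j] of copy [i] by the pair of the i-th letter and [j].  A
    repetition projects to two lazy walks on the path reading the same letters.
    As the two neighbours of a vertex carry different letters, the second walk is
    a shifted or a mirrored copy of the first ([walks_shift_or_reflect]).  A shift
    makes the word contain a square, and a mirror makes the walks meet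
    ([walks_meet]).  At the meeting time both halves of the repetition are in the
    same copy with the same colour, so they are at the same vertex.

    Lower bound.  Suppose that fewer than 3k + k/2 colours suffice, let [A i] be
    the set of the k colours of copy i, and let s = k - k/2 + 1, so that there are
    at most 4k - s colours and 2s >= k + 2.  A repetition is described by a list
    of cells (p, q, x): the first half uses colour x in copy p while the second
    half uses it in copy q.  All that matters is which of the sets [A p] and
    [A q] meet.  Consecutive sets are disjoint, hence two neighbouring pairs of
    sets share at least s colours ([overlap_window]).  Since xyxy and xyzxyz are
    excluded, this forces some i among any four consecutive positions to be
    _heavy_: [A i] and [A (i+2)] share at least s colours
    ([heavy_within_four]).  Heavy positions are never adjacent, and two further
    repetitions show that they are not at distance 2 ([no_gap2]) or 3
    ([no_gap3]).  So from some point on they are exactly every fourth position,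
    as in the word abac babc abac babc, which is a square.  The last step recovers
    this repetition of period 8 from the sets ([no_gaps4]).

    The tool behind all this is counting: two k-sets that both avoid a set of size
    w share at least w + s - 2k colours ([card_meet]).  Large overlaps between some
    copies therefore create overlaps between others ([overlap_link]). *)

Set Implicit Arguments.
Unset Strict Implicit.
Unset Printing Implicit Defensive.

(** * Square-free words *)

Definition square_free (T : Type) (f : nat -> T) :=
  forall i t, 0 < t -> ~ forall j, j < t -> f (i + j) = f (i + t + j).

Lemma square_free_succ (T : Type) (f : nat -> T) i :
  square_free f -> f i <> f i.+1.
Proof.
by move=> sqf fi; apply: (sqf i 1) => // -[|//] _; rewrite !addn0 addn1.
Qed.

(** The parity of the number of binary digits 1 of [n]; [m] is fuel, and any
    [m >= n] gives this value. *)
Fixpoint thue_morse_rec m n :=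
  if m is m'.+1 then odd n (+) thue_morse_rec m' n./2 else false.

Definition thue_morse n := thue_morse_rec n n.

Lemma thue_morse_recE m n : n <= m -> thue_morse_rec m n = thue_morse n.
Proof.
rewrite /thue_morse; elim/ltn_ind: n m => -[|n] IHn [|m] // nm.
  by elim: m.+1 => //= i ->.
rewrite /=; congr (_ (+) _).
by rewrite (IHn (uphalf n)) ?[RHS](IHn (uphalf n)) //; lia.
Qed.

Lemma thue_morseE n : thue_morse n = odd n (+) thue_morse n./2.
Proof. by case: n => // n; rewrite {1}/thue_morse /= thue_morse_recE //; lia. Qed.

Lemma thue_morse_double n : thue_morse n.*2 = thue_morse n.
Proof. by rewrite thue_morseE odd_double doubleK. Qed.

Lemma thue_morse_doubleS n : thue_morse n.*2.+1 = ~~ thue_morse n.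
Proof. by rewrite thue_morseE /= odd_double uphalf_double. Qed.

(** For odd [t], one of [j] and [j + t] is even, and the letters at an even position
    and at its successor differ.  So the letters alternate along the whole window,
    which is incompatible with an odd period.  For even [t], the positions of one
    parity form a window of half the period. *)
Lemma thue_morse_overlap_free i t : 0 < t ->
  ~ forall j, j <= t -> thue_morse (i + j) = thue_morse (i + t + j).
Proof.
elim/ltn_ind: t i => t IHt i t0 per.
have [t2 | t2] := boolP (odd t).
  have alt n : ~~ odd n -> thue_morse n.+1 = ~~ thue_morse n.
    move=> on; have -> : n = n./2.*2 by lia.
    by rewrite thue_morse_doubleS thue_morse_double.
  have step j : j < t -> thue_morse (i + j.+1) = ~~ thue_morse (i + j).
    move=> jt; have [o | o] := boolP (odd (i + j)).
      rewrite (per _ jt) (per _ (ltnW jt)) addnS alt //; lia.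
    by rewrite addnS alt.
  have alts j : j <= t -> thue_morse (i + j) = odd j (+) thue_morse i.
    elim: j => [|j IHj] jt; first by rewrite addn0.
    by rewrite step // IHj ?(ltnW jt) //=; case: odd; case: thue_morse.
  have := per 0 (leq0n t); rewrite !addn0 alts // t2; by case: thue_morse.
have tE : t = t./2.*2 by lia.
have iE : i = odd i + i./2.*2 by rewrite odd_double_half.
apply: (IHt t./2 _ i./2) => [||j jt]; [lia | lia |].
have := per j.*2; have [o | o] := boolP (odd i).
  have -> : i + j.*2 = (i./2 + j).*2.+1 by lia.
  have -> : i + t + j.*2 = (i./2 + t./2 + j).*2.+1 by lia.
  by rewrite !thue_morse_doubleS => h; apply/negb_inj/h; lia.
have -> : i + j.*2 = (i./2 + j).*2 by lia.
have -> : i + t + j.*2 = (i./2 + t./2 + j).*2 by lia.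
by rewrite !thue_morse_double; apply; lia.
Qed.

(** The differences of consecutive letters of the Thue-Morse word, modulo 3. *)
Definition ternary n :=
  if thue_morse n == thue_morse n.+1 then 0 else if thue_morse n then 1 else 2.

(** The differences determine a Thue-Morse letter from its predecessor.  If the
    letters at the starts of the two halves agree, then a square of differences is
    an overlap.  If they disagree, equal differences must all vanish, so the word is
    constant from one start to the other, which is a contradiction. *)
Lemma ternary_square_free : square_free ternary.
Proof.
move=> i t t0 sq.
have [e | e] := eqVneq (thue_morse i) (thue_morse (i + t)).
  apply: (@thue_morse_overlap_free i t t0); elim=> [|j IHj] jt.
    by rewrite !addn0.
  have := sq j jt; have := IHj (ltnW jt); rewrite /ternary !addnS => ->.
  by case: (thue_morse (i + t + j)); case: (thue_morse (i + j).+1);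
    case: (thue_morse (i + t + j).+1).
have cst j : j <= t -> thue_morse (i + j) = thue_morse i /\
    thue_morse (i + t + j) = thue_morse (i + t).
  elim: j => [|j IHj] jt; first by rewrite !addn0.
  have := sq j jt; have [{}IHj IHj'] := IHj (ltnW jt).
  rewrite /ternary !addnS IHj IHj'; move: e.
  by case: (thue_morse i); case: (thue_morse (i + t)); case: (thue_morse (i + j).+1);
    case: (thue_morse (i + t + j).+1).
by have [h _] := cst t (leqnn t); rewrite h eqxx in e.
Qed.

(** The letter 3 is inserted after every second letter of [ternary]. *)
Definition quaternary n :=
  if n %% 3 == 2 then 3 else ternary (n %/ 3 * 2 + n %% 3).

Lemma ternary_lt n : ternary n < 3.
Proof. by rewrite /ternary; case: ifP => // _; case: ifP. Qed.

Lemma quaternary_lt n : quaternary n < 4.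
Proof. by rewrite /quaternary; case: ifP => // _; apply: leqW (ternary_lt _). Qed.

Lemma quaternary_eq3 n : (quaternary n == 3) = (n %% 3 == 2).
Proof.
rewrite /quaternary; case: ifP => // _.
by have := ternary_lt (n %/ 3 * 2 + n %% 3); lia.
Qed.

Lemma quaternary_pal n : quaternary n <> quaternary n.+2.
Proof.
move=> e; have := quaternary_eq3 n; have := quaternary_eq3 n.+2; rewrite -e => -> n2.
move: e; rewrite /quaternary; case: eqP => [|m2]; case: eqP => [|m2']; try lia.
have -> : n.+2 %/ 3 * 2 + n.+2 %% 3 = (n %/ 3 * 2 + n %% 3).+1 by lia.
exact: square_free_succ ternary_square_free.
Qed.

(** Within three consecutive positions there is a 3, so the period of a square of
    period at least 3 is a multiple of 3.  Erasing the letters 3 then leaves a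
    square of [ternary]. *)
Lemma quaternary_square_free : square_free quaternary.
Proof.
move=> i t t0 sq.
have m3 j : j < t -> ((i + j) %% 3 == 2) = ((i + t + j) %% 3 == 2).
  by move=> jt; rewrite -!quaternary_eq3 sq.
have [t1 | t1] := eqVneq t 1.
  have := sq 0; rewrite t1 !addn0 => /(_ isT); have := m3 0; rewrite t1 /quaternary => m.
  case: eqP; case: eqP; try lia.
  move=> h h'.
  have -> : (i + 1) %/ 3 * 2 + (i + 1) %% 3 = (i %/ 3 * 2 + i %% 3).+1 by lia.
  exact: square_free_succ ternary_square_free.
have [t2 | t2] := eqVneq t 2.
  by apply: (@quaternary_pal i); have := sq 0; rewrite t2 !addn0 addn2 => /(_ isT).
have dt : t %% 3 = 0 by have := m3 0; have := m3 1; have := m3 2; lia.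
apply: (@ternary_square_free (i %/ 3 * 2 + i %% 3) (t %/ 3 * 2)); first lia.
(* [m] is an index in the ternary word and [pos] its position in [quaternary]. *)
move=> j jt; set m := i %/ 3 * 2 + i %% 3 + j.
pose pos := m %/ 2 * 3 + m %% 2.
have := sq (pos - i).
have ip : i <= pos by rewrite /pos /m; lia.
have -> : i + (pos - i) = pos by lia.
have -> : i + t + (pos - i) = pos + t by lia.
rewrite /quaternary; case: eqP => [|_]; first by rewrite /pos; lia.
case: eqP => [|_]; first by rewrite /pos; lia.
have -> : pos %/ 3 * 2 + pos %% 3 = m by rewrite /pos; lia.
have -> : (pos + t) %/ 3 * 2 + (pos + t) %% 3 =
    i %/ 3 * 2 + i %% 3 + t %/ 3 * 2 + j by rewrite /pos; lia.
by apply; rewrite /pos /m; lia.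
Qed.

(** * Walks of equal colour on a path *)

Definition close (a b : nat) := (a <= b.+1) && (b <= a.+1).

Definition lazy_walk l (w : nat -> nat) := forall j, j < l -> close (w j) (w j.+1).

Lemma walk_ivt l w x : lazy_walk l w ->
  (w 0 <= x <= w l) || (w l <= x <= w 0) -> exists2 i, i <= l & w i = x.
Proof.
elim: l => [|l IHl] wl wx; first by exists 0; lia.
have [wx' | wx'] := boolP ((w 0 <= x <= w l) || (w l <= x <= w 0)).
  have [|i il <-] := IHl _ wx'; first by move=> j jl; apply: wl; lia.
  by exists i => //; lia.
by exists l.+1 => //; have := wl l (ltnSn l); rewrite /close; lia.
Qed.

Section Walks.

Variables (T : Type) (f : nat -> T).
Hypothesis sqf : square_free f.
Hypothesis palf : forall i, f i <> f i.+2.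

Lemma close_eq a b : close a b -> f a = f b -> a = b.
Proof.
have st := square_free_succ sqf.
move=> ab fab; have [] // : [\/ a = b, b = a.+1 | a = b.+1].
- move: ab; rewrite /close => ab.
  case: (ltngtP a b) => h; [apply: Or32|apply: Or33|apply: Or31]; lia.
- by move=> bE; case: (st a); rewrite -bE.
- by move=> aE; case: (st b); rewrite -aE.
Qed.

Lemma neighbour_eq b a c : close a b -> close b c -> a != b -> c != b ->
  f a = f c -> a = c.
Proof.
rewrite /close => ab bc nab ncb fac.
have [] // : [\/ a = c, c = a.+2 | a = c.+2].
- case: (ltngtP a c) => h; [apply: Or32|apply: Or33|apply: Or31]; lia.
- by move=> cE; case: (palf (i := a)); rewrite -cE.
- by move=> aE; case: (palf (i := c)); rewrite -aE.
Qed.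

Variables (l : nat) (w w' : nat -> nat).
Hypothesis wl : lazy_walk l w.
Hypothesis wl' : lazy_walk l w'.
Hypothesis fww' : forall i, i <= l -> f (w i) = f (w' i).

(** As long as both walks stand still nothing is decided.  The first move goes in
    equal or in opposite directions, and from then on a move of one walk back to
    the vertex it came from is matched by such a move of the other.  The induction
    hence carries the pair [a, a'] of the vertices visited before the last move. *)
Lemma walks_shift_or_reflect :
  (forall i, i <= l -> w i + w' 0 = w 0 + w' i) \/
  (forall i, i <= l -> w i + w' i = w 0 + w' 0).
Proof.
suff: [\/ forall i, i <= l -> w i = w 0 /\ w' i = w' 0,
    (forall i, i <= l -> w i + w' 0 = w 0 + w' i) /\
    exists a a', [/\ f a = f a', close a (w l), close a' (w' l), a != w l
                   & a + w' l = a' + w l] |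
    (forall i, i <= l -> w i + w' i = w 0 + w' 0) /\
    exists a a', [/\ f a = f a', close a (w l), close a' (w' l), a != w l
                   & a + a' = w l + w' l]].
  case=> [e|[e _]|[e _]]; [left|by left|by right].
  by move=> i /e[-> ->].
elim: l wl wl' fww' => [|n IHn] vl vl' fv.
  by apply: Or31 => i; rewrite leqn0 => /eqP->.
have := IHn (fun j jn => vl j (ltnW jn)) (fun j jn => vl' j (ltnW jn))
  (fun j jn => fv j (leqW jn)).
have c := vl n (ltnSn n); have c' := vl' n (ltnSn n).
have fn := fv n (leqnSn n); have fn1 := fv n.+1 (leqnn _).
have same : (w n.+1 == w n) = (w' n.+1 == w' n).
  apply/eqP/eqP => e.
    by apply/esym/close_eq => //; rewrite -fn1 e.
  by apply/esym/close_eq => //; rewrite fn1 e.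
(* Returning to the previous vertex is visible in the colours, because the two
   neighbours of a vertex are coloured differently. *)
have back a a' : f a = f a' -> close a (w n) -> close a' (w' n) ->
    a != w n -> a' != w' n -> w n.+1 != w n -> (w n.+1 == a) = (w' n.+1 == a').
  move=> faa' ca ca' na na' nw; have nw' : w' n.+1 != w' n by rewrite -same.
  apply/eqP/eqP => h.
    by apply/esym/(@neighbour_eq (w' n)); rewrite // -fn1 h.
  by apply/esym/(@neighbour_eq (w n)); rewrite // fn1 h.
have upto (P : nat -> Prop) : (forall i, i <= n -> P i) -> P n.+1 ->
    forall i, i <= n.+1 -> P i.
  by move=> Pn Pn1 i; rewrite leq_eqVlt ltnS => /orP[/eqP->|/Pn].
case=> [e|[e [a [a' [faa' ca ca' na ea]]]]|[e [a [a' [faa' ca ca' na ea]]]]].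
- have [en en'] := e n (leqnn n).
  have [ew | nw] := eqVneq (w n.+1) (w n).
    apply: Or31; apply: upto => //; split; first by rewrite ew.
    by move: same; rewrite ew eqxx => /esym/eqP->.
  have nw' : w' n.+1 != w' n by rewrite -same.
  have [s | s] : (w n.+1 + w' n = w n + w' n.+1) \/ (w n.+1 + w' n.+1 = w n + w' n).
  - by move: c c' nw nw'; rewrite /close; lia.
  - apply: Or32; split.
      by apply: upto => [i /e[-> ->] //|]; move: s; rewrite en en'.
    by exists (w n), (w' n); split=> //; rewrite 1?eq_sym //; lia.
  - apply: Or33; split.
      by apply: upto => [i /e[-> ->] //|]; move: s; rewrite en en'.
    by exists (w n), (w' n); split=> //; rewrite 1?eq_sym //; lia.
- apply: Or32; have en := e n (leqnn n).
  have na' : a' != w' n by lia.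
  have [ew | nw] := eqVneq (w n.+1) (w n).
    have ew' : w' n.+1 = w' n by apply/eqP; rewrite -same ew.
    split; last by exists a, a'; rewrite ew ew'.
    by apply: upto => //; rewrite ew ew'.
  have nw' : w' n.+1 != w' n by rewrite -same.
  have bk := back _ _ faa' ca ca' na na' nw.
  split; last exists (w n), (w' n); first apply: upto => //.
    by move: c c' ca ca'; rewrite /close; lia.
  by split=> //; rewrite 1?eq_sym //; move: c c' ca ca'; rewrite /close; lia.
- apply: Or33; have en := e n (leqnn n).
  have na' : a' != w' n by lia.
  have [ew | nw] := eqVneq (w n.+1) (w n).
    have ew' : w' n.+1 = w' n by apply/eqP; rewrite -same ew.
    split; last by exists a, a'; rewrite ew ew'.
    by apply: upto => //; rewrite ew ew'.
  have nw' : w' n.+1 != w' n by rewrite -same.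
  have bk := back _ _ faa' ca ca' na na' nw.
  split; last exists (w n), (w' n); first apply: upto => //.
    by move: c c' ca ca'; rewrite /close; lia.
  by split=> //; rewrite 1?eq_sym //; move: c c' ca ca'; rewrite /close; lia.
Qed.

(** Let [t] be the distance of the starting points.  If one walk is the other
    shifted by [t], then reaching the start of the second walk makes the first one
    cross an interval of length [t], which gives a square.  If the walks are
    mirror images that never meet, then they stay on their sides of the mirror,
    because crossing it would put two equal colours on adjacent vertices; so the
    first walk cannot come near the start of the second one. *)
Lemma walks_meet : close (w l) (w' 0) -> exists2 i, i <= l & w i = w' i.
Proof.
rewrite /close => cl; have [e|e] := walks_shift_or_reflect; last first.
  have [i /andP[il /eqP wi]|no] :=
      pickP (fun i : 'I_l.+1 => (i <= l) && (w i == w' i)).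
    by exists i.
  have {}no i : i <= l -> w i != w' i.
    move=> il; by have := no (Ordinal (il : i < l.+1)); rewrite /= il /= => ->.
  have side i : i <= l -> (w i < w' i) = (w 0 < w' 0).
    elim: i => // i IHi il; rewrite -IHi ?(ltnW il) //.
    have ne := no _ (ltnW il); have ne' := no _ il.
    have c := wl il; have c' := wl' il.
    have := e _ il; have := e _ (ltnW il).
    have := @close_eq (w i) (w' i); rewrite (fww' (ltnW il)) /close in c c' *.
    by move=> h; have {}h := fun x => h x erefl; lia.
  have := side l (leqnn l); have := e l (leqnn l); have := no l (leqnn l).
  have := no 0 (leq0n l); have := @close_eq (w l) (w' l).
  rewrite (fww' (leqnn l)) /close => h; have {}h := fun x => h x erefl.
  lia.
have [w0 | n0] := eqVneq (w 0) (w' 0); first by exists 0.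
exfalso; have el := e l (leqnn l).
case: (ltnP (w 0) (w' 0)) => h.
  apply: (@sqf (w 0) (w' 0 - w 0)) => [|j jt]; first by lia.
  have [|i il wi] := @walk_ivt l w (w 0 + j) wl; first by lia.
  by rewrite -wi fww' //; congr f; have := e i il; lia.
apply: (@sqf ((w' 0).+1 + w' 0 - w 0) (w 0 - w' 0)) => [|j jt]; first by lia.
have [|i il wi] := @walk_ivt l w ((w' 0).+1 + j) wl; first by lia.
have -> : (w' 0).+1 + w' 0 - w 0 + (w 0 - w' 0) + j = w i by lia.
by rewrite fww' //; congr f; have := e i il; lia.
Qed.

End Walks.

(** * Colouring with 4k colours *)

(** Since [j < k], the colour [a * k + j] encodes the letter [a] and the vertex [j].
    So equal colours give equal letters, and where the two halves of a repetition
    are in the same copy they are at the same vertex. *)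
Lemma colorable_4k n k :
  nonrep_colorable (lex_product (@path_graph n) (@complete_graph k)) (4 * k).
Proof.
have lt4k (u : 'I_n * 'I_k) : quaternary u.1 * k + u.2 < 4 * k.
  apply: (@leq_trans ((quaternary u.1).+1 * k)).
    by rewrite mulSn addnC ltn_add2r.
  by rewrite leq_mul2r quaternary_lt orbT.
exists (fun u => Ordinal (lt4k u)) => p /andP[sp up] [l [l0]].
rewrite size_map => szp rep.
have [x0 _] : exists x0, x0 \in p.
  case: p szp {sp up rep} => [|x p] /= szp; first lia.
  by exists x; rewrite mem_head.
pose w j : nat := (nth x0 p j).1.
have cl j : j.+1 < l.*2 -> close (w j) (w j.+1).
  rewrite -szp => jp; have /(sortedP x0)/(_ _ jp) := sp.
  rewrite /lex_product /path_graph /close /w /= => /orP[|/andP[/eqP-> _]]; lia.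
have col j : j < l -> quaternary (w j) = quaternary (w (l + j)) /\
    (nth x0 p j).2 = (nth x0 p (l + j)).2.
  move=> jl; have := rep j jl.
  rewrite !onth_map !onthE !(nth_map x0) /= ?szp; [|lia|lia].
  case=> e; have k0 := leq_ltn_trans (leq0n _) (ltn_ord (nth x0 p j).2).
  have := congr1 (divn^~ k) e; have := congr1 (modn^~ k) e.
  rewrite /= !modnMDl !modn_small // !divnMDl // !divn_small // !addn0.
  by move=> e2 e1; split=> //; apply: val_inj.
have [i il wi] : exists2 i, i <= l.-1 & w i = w (l + i).
  apply: (walks_meet quaternary_square_free quaternary_pal
    (w := w) (w' := fun i => w (l + i))).
  - by move=> j jl; apply: cl; lia.
  - by move=> j jl; rewrite addnS; apply: cl; lia.
  - by move=> j jl; apply: (col _ _).1; lia.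
  - by have := cl l.-1; rewrite addn0 prednK //; apply; lia.
have il' : i < l by lia.
have : nth x0 p i == nth x0 p (l + i).
  by rewrite [nth x0 p i]surjective_pairing [nth x0 p (l + i)]surjective_pairing
    (col i il').2; apply/eqP; congr (_, _); apply: val_inj.
by rewrite nth_uniq // ?szp; lia.
Qed.


(** * Families of colour sets without repetitions *)

(** The union of [X] and [Y] lies in the complement of [W]. *)
Lemma card_meet (C : finType) (X Y W : {set C}) :
  #|X :&: W| = 0 -> #|Y :&: W| = 0 -> #|X| + #|Y| + #|W| <= #|C| + #|X :&: Y|.
Proof.
move=> XW YW.
have : #|(X :|: Y) :&: W| = 0.
  move/eqP: XW; move/eqP: YW; rewrite setIUl !cards_eq0 => /eqP-> /eqP->.
  by rewrite setU0 cards0.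
have : #|X :|: Y :|: W| <= #|C| := max_card _.
by have := cardsUI X Y; have := cardsUI (X :|: Y) W; lia.
Qed.

Lemma card_share (C : finType) (B X Y : {set C}) :
  #|B :&: X| + #|B :&: Y| <= #|B| + #|X :&: Y|.
Proof.
rewrite -cardsUI; apply: leq_add; apply: subset_leq_card; apply/subsetP => x.
  by rewrite !inE => /orP[] /andP[].
by rewrite !inE => /andP[/andP[_ ->] /andP[_ ->]].
Qed.

Definition near (C : Type) (u v : nat * C) := close u.1 v.1.

(** A cell [(p, q, x)] stands for the colour [x] used in copy [p] by the first half of
    a sequence and in copy [q] by the second half.  With this encoding the two
    halves have equal colours by construction. *)
Definition halves (C : Type) (s : seq (nat * nat * C)) : seq (nat * C) :=
  [seq (c.1.1, c.2) | c <- s] ++ [seq (c.1.2, c.2) | c <- s].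

Definition listed (C : finType) n (A : nat -> {set C}) (u : nat * C) :=
  (u.1 < n) && (u.2 \in A u.1).

(** Vertex [(p, x)] is the vertex of colour [x] in copy [p]; as each copy is a complete
    graph, moves inside a copy and between neighbouring copies are all allowed. *)
Record nonrep_family (C : finType) (k n : nat) (A : nat -> {set C}) : Prop :=
    NonrepFamily {
  family_card : forall i, i < n -> #|A i| = k;
  family_norep : forall s, s != [::] -> all (listed n A) (halves s) ->
    sorted (@near C) (halves s) -> uniq (halves s) -> False }.

Lemma family_shift (C : finType) k n A a b : @nonrep_family C k n A -> a + b <= n ->
  nonrep_family k b (fun i => A (i + a)).
Proof.
move=> [Ak Ar] ab; split=> [i ib | s s0 sl sn su]; first by apply: Ak; lia.
pose sh (u : nat * C) := (u.1 + a, u.2).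
pose s' := [seq (c.1.1 + a, c.1.2 + a, c.2) | c <- s].
have hs' : halves s' = map sh (halves s).
  by rewrite /halves map_cat -!map_comp.
apply: (Ar s').
- by rewrite -size_eq0 size_map size_eq0.
- rewrite hs' all_map; apply: sub_all sl => u /andP[/= u1 u2].
  by rewrite /listed /= u2 andbT; lia.
- rewrite hs'; apply: homo_sorted sn => u v; rewrite /near /close /=; lia.
- rewrite hs' map_inj_uniq // => -[p x] [q y] [] /addIn -> -> //.
Qed.

Lemma family_rev (C : finType) k n A : @nonrep_family C k n A ->
  nonrep_family k n (fun i => A (n.-1 - i)).
Proof.
move=> [Ak Ar]; split=> [i ib | s s0 sl sn su]; first by apply: Ak; lia.
pose fl (u : nat * C) := (n.-1 - u.1, u.2).
pose s' := [seq (n.-1 - c.1.2, n.-1 - c.1.1, c.2) | c <- rev s].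
have hs' : halves s' = rev (map fl (halves s)).
  by rewrite /halves map_cat rev_cat -!map_comp -!map_rev.
apply: (Ar s').
- by rewrite -size_eq0 size_map size_rev size_eq0.
- rewrite hs' all_rev all_map; apply: sub_all sl => u /andP[/= u1 u2].
  by rewrite /listed /= u2 andbT; lia.
- rewrite hs' rev_sorted; apply: homo_sorted sn => u v; rewrite /near /close /=; lia.
- rewrite hs' rev_uniq map_inj_in_uniq // => -[p x] [q y] pl ql [] pq ->.
  move/allP: sl => sl; move: (sl _ pl) (sl _ ql) => /andP[/= ? _] /andP[/= ? _].
  by congr (_, _); lia.
Qed.

Definition overlap (C : finType) (A : nat -> {set C}) p q := #|A p :&: A q|.

Section Overlaps.

Variables (C : finType) (k s : nat).
Hypothesis sk : k + 2 <= s + s.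
Hypothesis Cs : #|C| + s <= 4 * k.

Implicit Type A : nat -> {set C}.

Lemma overlapC A p q : overlap A p q = overlap A q p.
Proof. by rewrite /overlap setIC. Qed.

Lemma overlap0_neq A p q x y : overlap A p q = 0 -> x \in A p -> y \in A q ->
  x != y.
Proof.
move/eqP; rewrite cards_eq0 => /eqP pq xp yq; apply/eqP => xy.
by have := in_set0 x; rewrite -pq inE xp xy yq.
Qed.

Lemma overlap_pick A p q : 0 < overlap A p q -> exists x, x \in A p /\ x \in A q.
Proof. by case/card_gt0P => x /setIP[]; exists x. Qed.

Lemma overlap_pick2 A p q y : 1 < overlap A p q ->
  exists x, [/\ x \in A p, x \in A q & x != y].
Proof.
move=> pq; have /card_gt0P[x] : 0 < #|(A p :&: A q) :\ y|.
  by move: pq; rewrite /overlap (cardsD1 y); lia.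
by rewrite !inE => /and3P[? ? ?]; exists x.
Qed.

(** The form of distinctness in which only vertices of the same copy need a
    comparison of colours; positions given as numerals are settled by computation. *)
Lemma no_repetition n A r : nonrep_family k n A -> r != [::] ->
  all (listed n A) (halves r) -> sorted (@near C) (halves r) ->
  pairwise (fun u v => (u.1 == v.1) ==> (u.2 != v.2)) (halves r) -> False.
Proof.
move=> fA r0 lr nr ur; apply: (family_norep fA r0 lr nr).
rewrite uniq_pairwise; apply: sub_pairwise ur => -[p x] [q y] /=.
by rewrite xpair_eqE negb_and implybE.
Qed.

Lemma overlap_succ n A p : nonrep_family k n A -> p.+1 < n -> overlap A p p.+1 = 0.
Proof.
move=> fA pn; apply/eqP; rewrite -leqn0 leqNgt.
apply/negP => /overlap_pick[x [xp xq]].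
apply: (no_repetition fA (r := [:: (p, p.+1, x)])) => //=.
- by rewrite /listed /= xp xq; lia.
- by rewrite /near /close /=; lia.
- by rewrite !andbT; lia.
Qed.

Lemma overlap_pred n A p : nonrep_family k n A -> p.+1 < n -> overlap A p.+1 p = 0.
Proof. by move=> fA pn; rewrite overlapC (overlap_succ fA). Qed.

(** The unions of [A p], [A p.+1] and of [A p.+2], [A p.+3] have [2 * k] elements each,
    so among [4 * k - s] colours they share [s], while [A p.+1] and [A p.+2] are disjoint. *)
Lemma overlap_window n A p : nonrep_family k n A -> p.+3 < n ->
  s <= overlap A p p.+2 + overlap A p.+1 p.+3 + overlap A p p.+3.
Proof.
move=> fA pn.
have d i : i <= p.+2 -> #|A i :&: A i.+1| = 0.
  by move=> ip; apply: (overlap_succ fA); lia.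
have := cardsUI (A p) (A p.+1); have := cardsUI (A p.+2) (A p.+3).
rewrite !d ?(family_card fA); try lia.
have := cardsUI (A p :|: A p.+1) (A p.+2 :|: A p.+3).
have : #|A p :|: A p.+1 :|: (A p.+2 :|: A p.+3)| <= #|C| := max_card _.
rewrite setIUl !setIUr; have := d p.+1.
have := (leq_card_setU (A p :&: A p.+2 :|: A p :&: A p.+3)
  (A p.+1 :&: A p.+2 :|: A p.+1 :&: A p.+3)).1.
have := (leq_card_setU (A p :&: A p.+2) (A p :&: A p.+3)).1.
have := (leq_card_setU (A p.+1 :&: A p.+2) (A p.+1 :&: A p.+3)).1.
rewrite /overlap; lia.
Qed.

Lemma no_xyxy A : nonrep_family k 4 A -> 0 < overlap A 0 2 -> overlap A 1 3 = 0.
Proof.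
move=> fA /overlap_pick[x [xp xq]]; apply/eqP; rewrite -leqn0 leqNgt.
apply/negP => /overlap_pick[y [yp yq]].
apply: (no_repetition fA (r := [:: (0, 2, x); (1, 3, y)])) => //=.
by rewrite /listed /= xp xq yp yq.
Qed.

Lemma no_xyzxyz A : nonrep_family k 6 A ->
  0 < overlap A 0 3 -> 0 < overlap A 1 4 -> overlap A 2 5 = 0.
Proof.
move=> fA /overlap_pick[x [xp xq]] /overlap_pick[y [yp yq]].
apply/eqP; rewrite -leqn0 leqNgt.
apply/negP => /overlap_pick[z [zp zq]].
apply: (no_repetition fA (r := [:: (0, 3, x); (1, 4, y); (2, 5, z)])) => //=.
by rewrite /listed /= xp xq yp yq zp zq.
Qed.

Lemma overlap2_succ n A p : nonrep_family k n A -> p.+3 < n ->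
  0 < overlap A p p.+2 -> overlap A p.+1 p.+3 = 0.
Proof. by move=> fA pn; apply: no_xyxy (family_shift fA _); rewrite addn4. Qed.

Lemma overlap2_pred n A p : nonrep_family k n A -> p.+3 < n ->
  0 < overlap A p.+1 p.+3 -> overlap A p p.+2 = 0.
Proof.
move=> fA pn d1; apply/eqP; rewrite -leqn0 leqNgt; apply/negP.
by move/(overlap2_succ fA pn); lia.
Qed.

Lemma overlap3_succ2 n A p : nonrep_family k n A -> p.+3.+2 < n ->
  0 < overlap A p p.+3 -> 0 < overlap A p.+1 p.+4 -> overlap A p.+2 p.+3.+2 = 0.
Proof. by move=> fA pn; apply: (no_xyzxyz (family_shift fA _)); rewrite addnC. Qed.

(** By [no_xyzxyz] one of three consecutive overlaps at distance 3 is empty.  In the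
    corresponding window the two overlaps at distance 2 make up [s], and by
    [no_xyxy] one of these two is empty. *)
Lemma heavy_within_four n A p : nonrep_family k n A -> p.+3.+2 < n ->
  [|| s <= overlap A p p.+2, s <= overlap A p.+1 p.+3, s <= overlap A p.+2 p.+4 |
      s <= overlap A p.+3 p.+3.+2].
Proof.
move=> fA pn.
have := @overlap_window n A p fA; have := @overlap_window n A p.+1 fA.
have := @overlap_window n A p.+2 fA.
have := @overlap2_succ n A p fA; have := @overlap2_succ n A p.+1 fA.
have := @overlap2_succ n A p.+2 fA.
have := @overlap3_succ2 n A p fA; lia.
Qed.

Lemma overlap_trans n A a b c : nonrep_family k n A -> b < n ->
  s <= overlap A a b -> s <= overlap A b c -> 1 < overlap A a c.
Proof.
move=> fA bn; have := card_share (A b) (A a) (A c).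
by rewrite (family_card fA) // (setIC (A b) (A a)) /overlap; lia.
Qed.

Lemma setI_overlap A X p : #|X :&: A p| = 0 -> forall Y, #|X :&: (A p :&: Y)| = 0.
Proof.
move=> Xp Y; apply/eqP; rewrite -leqn0 -Xp setIA; apply: subset_leq_card.
exact: subsetIl.
Qed.

(** [A p] and [A q] both avoid the union of [A j] and [A a :&: A b]. *)
Lemma overlap_link n A p q j a b : nonrep_family k n A -> p < n -> q < n -> j < n ->
  overlap A p j = 0 -> overlap A q j = 0 -> overlap A p a = 0 -> overlap A q b = 0 ->
  overlap A j a = 0 -> overlap A a b + s <= k + overlap A p q.
Proof.
move=> fA pn qn jn pj qj pa qb ja.
have W : #|A j :|: A a :&: A b| = k + overlap A a b.
  have := cardsUI (A j) (A a :&: A b).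
  by rewrite (setI_overlap ja) (family_card fA) // addn0.
have X0 : #|A p :&: (A j :|: A a :&: A b)| = 0.
  have := cardsUI (A p :&: A j) (A p :&: (A a :&: A b)).
  rewrite -setIUr; have := setI_overlap pa (A b); move: pj; rewrite /overlap; lia.
have Y0 : #|A q :&: (A j :|: A a :&: A b)| = 0.
  have := cardsUI (A q :&: A j) (A q :&: (A a :&: A b)).
  rewrite -setIUr; have := setI_overlap qb (A a); rewrite (setIC (A b)).
  by move: qj; rewrite /overlap; lia.
have := card_meet X0 Y0; rewrite W !(family_card fA) //; rewrite /overlap; lia.
Qed.

(** [A p] and [A q] both avoid the [2 * k] colours of [A i] and [A j]. *)
Lemma overlap_pair n A p q i j : nonrep_family k n A ->
  p < n -> q < n -> i < n -> j < n -> overlap A p i = 0 -> overlap A q i = 0 ->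
  overlap A p j = 0 -> overlap A q j = 0 -> overlap A i j = 0 -> s <= overlap A p q.
Proof.
move=> fA pn qn iN jn pi qi pj qj ij.
have := @overlap_link n A p q i j j fA pn qn iN pi qi pj qj ij.
by rewrite {1}/overlap setIid (family_card fA) //; lia.
Qed.

(** [A p] and the [2 * k] colours of [A q] and [A q.+1] all avoid [A i :&: A j]. *)
Lemma overlap_two n A p q i j : nonrep_family k n A -> p < n -> q.+1 < n ->
  overlap A p i = 0 -> overlap A q j = 0 -> overlap A q.+1 j = 0 ->
  overlap A i j + s <= k + #|A p :&: (A q :|: A q.+1)|.
Proof.
move=> fA pn qn pi qj qj'.
have X0 := setI_overlap pi (A j).
have Y0 : #|(A q :|: A q.+1) :&: (A i :&: A j)| = 0.
  rewrite (setIC (A i)) setIUl.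
  have := cardsUI (A q :&: (A j :&: A i)) (A q.+1 :&: (A j :&: A i)).
  by rewrite (setI_overlap qj) (setI_overlap qj'); lia.
have := card_meet X0 Y0; have := cardsUI (A q) (A q.+1).
have := overlap_succ fA qn; rewrite /overlap !(family_card fA); lia.
Qed.

Lemma two_pick A p q y : 1 < #|A p :&: (A q :|: A q.+1)| ->
  exists b x, [/\ b = q \/ b = q.+1, x \in A p, x \in A b & x != y].
Proof.
move=> pq; have /card_gt0P[x] : 0 < #|(A p :&: (A q :|: A q.+1)) :\ y|.
  by move: pq; rewrite (cardsD1 y); lia.
rewrite !inE => /and3P[xy xp /orP[]]; [exists q, x | exists q.+1, x];
  by split; auto.
Qed.

Lemma card_three n A p : nonrep_family k n A -> p.+2 < n ->
  3 * k <= #|A p :|: A p.+1 :|: A p.+2| + overlap A p p.+2.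
Proof.
move=> fA pn.
have := cardsUI (A p) (A p.+1); have := cardsUI (A p :|: A p.+1) (A p.+2).
have := (leq_card_setU (A p :&: A p.+2) (A p.+1 :&: A p.+2)).1.
rewrite setIUl; have := @overlap_succ n A p fA; have := @overlap_succ n A p.+1 fA.
by rewrite /overlap !(family_card fA); lia.
Qed.

(** Three consecutive sets whose outer ones share fewer than [s] colours cover more
    than [3 * k - s] of at most [4 * k - s] colours, so no [k] colours avoid them. *)
Lemma three_pick n A p q : nonrep_family k n A -> p.+2 < n -> q < n ->
  overlap A p p.+2 < s ->
  exists b x, [/\ [\/ b = p, b = p.+1 | b = p.+2], x \in A b & x \in A q].
Proof.
move=> fA pn qn dp; have cW := card_three fA pn.
set W := _ :|: A p.+2 in cW.
have /card_gt0P[x] : 0 < #|A q :&: W|.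
  have := cardsUI (A q) W; have : #|A q :|: W| <= #|C| := max_card _.
  by rewrite (family_card fA) //; lia.
rewrite !inE => /andP[xq /orP[/orP[]|] xp]; [exists p|exists p.+1|exists p.+2];
  exists x; split=> //; by constructor.
Qed.

(** * Distances between heavy positions *)

(** Copies 0 to 6 look like xyzyxyz.  The second half of the repetition xyzy xyzy turns
    back at copy 6 and uses a second colour of copy 5. *)
Lemma no_gap2 A : nonrep_family k 7 A -> s <= overlap A 1 3 -> overlap A 3 5 < s.
Proof.
move=> fA d1; rewrite ltnNge; apply/negP => d3.
have d0 : overlap A 0 2 = 0 by apply: (@overlap2_pred 7 A 0 fA isT); lia.
have d2 : overlap A 2 4 = 0 by apply: (@overlap2_succ 7 A 1 fA isT); lia.
have d4 : overlap A 4 6 = 0 by apply: (@overlap2_succ 7 A 3 fA isT); lia.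
have S i : i < 6 -> overlap A i i.+1 = 0 by apply: overlap_succ fA.
have S' i : i < 6 -> overlap A i.+1 i = 0 by apply: overlap_pred fA.
have /overlap_pick[x [x0 x4]] : 0 < overlap A 0 4.
  have := @overlap_link 7 A 0 4 2 1 3 fA.
  by rewrite d0 (overlapC A 4 2) d2 !S ?S' //; lia.
have /overlap_pick[z [z2 z6]] : 0 < overlap A 2 6.
  have := @overlap_link 7 A 2 6 4 3 5 fA.
  by rewrite d2 (overlapC A 6 4) d4 !S ?S' //; lia.
have /overlap_pick[y' [y'3 y'5]] : 0 < overlap A 3 5 by lia.
have /(overlap_pick2 y')[y [y1 y5 yy']] :=
  @overlap_trans 7 A 1 3 5 fA isT d1 d3.
apply: (no_repetition fA
  (r := [:: (0, 4, x); (1, 5, y); (2, 6, z); (3, 5, y')])) => //=.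
  by rewrite /listed /= x0 x4 y1 y5 z2 z6 y'3 y'5.
by rewrite yy'.
Qed.

(** The copies look like x y z x z y x y z x.  One half of the repetition
    runs through copies 1 to 5, the other from 6 through 7 to 8 and back again to 7.
    The colours at the start and at the turning point only have to be found in one
    of three consecutive copies, which is where [three_pick] enters. *)
Lemma no_gap3_aux A : nonrep_family k 10 A ->
  overlap A 0 2 < s -> s <= overlap A 2 4 ->
  s <= overlap A 5 7 -> overlap A 7 9 < s ->
  overlap A 2 5 = 0 -> False.
Proof.
move=> fA d0 d2 d5 d7 t2.
have d1 : overlap A 1 3 = 0 by apply: (@overlap2_pred 10 A 1 fA isT); lia.
have d3 : overlap A 3 5 = 0 by apply: (@overlap2_succ 10 A 2 fA isT); lia.
have d4 : overlap A 4 6 = 0 by apply: (@overlap2_pred 10 A 4 fA isT); lia.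
have d6 : overlap A 6 8 = 0 by apply: (@overlap2_succ 10 A 5 fA isT); lia.
have S i : i < 9 -> overlap A i i.+1 = 0 by apply: overlap_succ fA.
have S' i : i < 9 -> overlap A i.+1 i = 0 by apply: overlap_pred fA.
have t3 : s <= overlap A 3 6 by have := @overlap_window 10 A 3 fA isT; lia.
have o15 : s <= overlap A 1 5.
  by apply: (@overlap_pair 10 A 1 5 2 3); rewrite // ?S ?S' // overlapC.
have o17 := @overlap_trans 10 A 1 5 7 fA isT o15 d5.
have o48 : 1 < overlap A 4 8.
  have := @overlap_link 10 A 4 8 6 5 7 fA.
  by rewrite d4 (overlapC A 8 6) d6 !S ?S' //; lia.
have o28 : 1 < overlap A 2 8.
  have [t4 | t4] := posnP (overlap A 4 7).
    apply: (@overlap_trans 10 A 2 4 8) => //.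
    by apply: (@overlap_pair 10 A 4 8 6 7); rewrite // ?S ?S' // overlapC.
  have t5 : overlap A 5 8 = 0 by apply: (@overlap3_succ2 10 A 3 fA isT); lia.
  have := @overlap_link 10 A 2 8 5 3 6 fA.
  by rewrite t2 (overlapC A 8 5) t5 (overlapC A 8 6) d6 (overlapC A 5 3) d3 !S //; lia.
have [a [u [a_ ua u6]]] := @three_pick 10 A 0 6 fA isT isT d0.
have [b [v [b_ vb v3]]] := @three_pick 10 A 7 3 fA isT isT d7.
have /overlap_pick[y' [y'5 y'7]] : 0 < overlap A 5 7 by lia.
have [y [y1 y7 yy']] := overlap_pick2 y' o17.
have /overlap_pick[z' [z'4 z'8]] := ltnW o48.
have [z [z2 z8 zz']] := overlap_pick2 z' o28.
have uy := overlap0_neq (S 6 isT) u6 y7.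
have uz := overlap0_neq d6 u6 z8.
have yv := overlap0_neq d1 y1 v3.
have vy' := overlap0_neq d3 v3 y'5.
have zv := overlap0_neq (S 2 isT) z2 v3.
have vz' := overlap0_neq (S 3 isT) v3 z'4.
apply: (no_repetition fA (r := [:: (a, 6, u); (1, 7, y); (2, 8, z); (3, b, v);
  (4, 8, z'); (5, 7, y')])) => //=.
- rewrite /listed /= ua u6 y1 y7 z2 z8 vb v3 z'4 z'8 y'5 y'7.
  by case: a_ => ->; case: b_ => ->.
- by case: a_ => ->; case: b_ => ->.
- case: a_ => ->; case: b_ => ->;
  by rewrite /= ?uy ?uz ?yv ?zv ?vy' ?vz' ?yy' ?zz'.
Qed.

(** One of the overlaps of copies 2, 5 and of copies 4, 7 is empty because copies 3
    and 6 overlap, and reversal exchanges the two cases. *)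
Lemma no_gap3 A : nonrep_family k 10 A ->
  overlap A 0 2 < s -> s <= overlap A 2 4 ->
  s <= overlap A 5 7 -> overlap A 7 9 < s -> False.
Proof.
move=> fA d0 d2 d5 d7; have [t2 | t2] := posnP (overlap A 2 5).
  exact: (no_gap3_aux fA).
apply: (no_gap3_aux (family_rev fA)); rewrite /= overlapC //.
have d3 : overlap A 3 5 = 0 by apply: (@overlap2_succ 10 A 2 fA isT); lia.
have d4 : overlap A 4 6 = 0 by apply: (@overlap2_pred 10 A 4 fA isT); lia.
have w3 := @overlap_window 10 A 3 fA isT.
by apply: (@overlap3_succ2 10 A 2 fA isT) => //; lia.
Qed.

(** Copies 3, 4, 5 form the block around the heavy position 3, and copies 2 and 6
    separate it from its neighbours.  The overlaps at distance 3 starting at 0, 1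
    and at 4, 5 are nonempty since no other position up to 6 is heavy, so those
    starting at 2 and 3 are empty.  Hence copies 2 and 6 both avoid the whole block,
    which has at least [2 * k] colours. *)
Lemma separator A : nonrep_family k 9 A -> overlap A 0 2 < s -> overlap A 1 3 < s ->
  overlap A 2 4 < s -> s <= overlap A 3 5 ->
  overlap A 4 6 < s -> overlap A 5 7 < s -> overlap A 6 8 < s ->
  [/\ overlap A 2 5 = 0, overlap A 3 6 = 0 & s <= overlap A 2 6].
Proof.
move=> fA b0 b1 b2 d3 b4 b5 b6.
have d2 : overlap A 2 4 = 0 by apply: (@overlap2_pred 9 A 2 fA isT); lia.
have d4 : overlap A 4 6 = 0 by apply: (@overlap2_succ 9 A 3 fA isT); lia.
have d01 := @overlap2_succ 9 A 0 fA isT; have w0 := @overlap_window 9 A 0 fA isT.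
have w1 := @overlap_window 9 A 1 fA isT.
have d56 := @overlap2_succ 9 A 5 fA isT; have w4 := @overlap_window 9 A 4 fA isT.
have w5 := @overlap_window 9 A 5 fA isT.
have t2 : overlap A 2 5 = 0 by apply: (@overlap3_succ2 9 A 0 fA isT); lia.
have t3 : overlap A 3 6 = 0 by have := @overlap3_succ2 9 A 3 fA isT; lia.
split=> //.
have S i : i < 8 -> overlap A i i.+1 = 0 by apply: overlap_succ fA.
have S' i : i < 8 -> overlap A i.+1 i = 0 by apply: overlap_pred fA.
have X0 : #|A 2 :&: (A 3 :|: A 4 :|: A 5)| = 0.
  apply/eqP; rewrite !setIUr !cards_eq0 !setU_eq0 -!cards_eq0 -!/(overlap _ _ _).
  by rewrite S // d2 t2.
have Y0 : #|A 6 :&: (A 3 :|: A 4 :|: A 5)| = 0.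
  apply/eqP; rewrite !setIUr !cards_eq0 !setU_eq0 -!cards_eq0 -!/(overlap _ _ _).
  by rewrite (overlapC A 6 3) t3 (overlapC A 6 4) d4 S'.
have d3k : overlap A 3 5 <= k.
  by rewrite -(family_card fA (i := 3)) //; apply/subset_leq_card/subsetIl.
have := card_meet X0 Y0; have := @card_three 9 A 3 fA isT.
rewrite !(family_card fA) // /overlap in d3k *; lia.
Qed.

(** Copies 0 and 4 are separators.  If the first copies 1 and 5 of their blocks had a
    common colour, the walk 0, 1, 2, 3 could be followed by a walk that starts at 4, 5
    and then stays in copies 5 and 6: copies 2 and 3 meet the union of these
    two, because all four avoid copy 4. *)
Lemma first_disjoint A : nonrep_family k 7 A ->
  0 < overlap A 0 4 -> overlap A 2 4 = 0 -> overlap A 4 6 = 0 -> overlap A 1 5 = 0.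
Proof.
move=> fA /overlap_pick[z [z0 z4]] d2 d4; apply/eqP; rewrite -leqn0 leqNgt.
apply/negP => /overlap_pick[u [u1 u5]].
have S i : i < 6 -> overlap A i i.+1 = 0 by apply: overlap_succ fA.
have S' i : i < 6 -> overlap A i.+1 i = 0 by apply: overlap_pred fA.
have o4 : overlap A 4 4 = k by rewrite /overlap setIid (family_card fA).
have c2 : 1 < #|A 2 :&: (A 5 :|: A 6)|.
  have := @overlap_two 7 A 2 5 4 4 fA; rewrite d2 (overlapC A 6) d4 S' // o4; lia.
have c3 : 1 < #|A 3 :&: (A 5 :|: A 6)|.
  have := @overlap_two 7 A 3 5 4 4 fA; rewrite (overlapC A 6) d4 S' // S // o4; lia.
have [b [v [b_ v2 vb vu]]] := two_pick u c2.
have [b' [w [b'_ w3 wb' wu]]] := two_pick u c3.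
have vw := overlap0_neq (S 2 isT) v2 w3.
rewrite eq_sym in vu; rewrite eq_sym in wu.
apply: (no_repetition fA
  (r := [:: (0, 4, z); (1, 5, u); (2, b, v); (3, b', w)])) => //=.
- by rewrite /listed /= z0 z4 u1 u5 v2 vb w3 wb'; case: b_ => ->; case: b'_ => ->.
- by case: b_ => ->; case: b'_ => ->.
- by case: b_ => ->; case: b'_ => ->; rewrite /= ?vu ?wu ?vw.
Qed.

Lemma last_disjoint A : nonrep_family k 7 A ->
  0 < overlap A 2 6 -> overlap A 0 2 = 0 -> overlap A 2 4 = 0 -> overlap A 1 5 = 0.
Proof.
move=> fA o26 d0 d2; rewrite overlapC.
by apply: (first_disjoint (family_rev fA)); rewrite /= overlapC.
Qed.

(** The separators are copies 3, 7, 11 and 15, around the blocks 4-6, 8-10, 12-14 and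
    16-18.  Consecutive separators share [s] colours, so those at distance 8 meet.
    The first copies of consecutive blocks are disjoint ([first_disjoint]), so by
    [overlap_link] the first copies of blocks at distance 8 meet, and likewise
    the last ones.  This leads a walk on 3 to 10 and its image on 11 to 17.  If
    copies 5 and 13 are disjoint, then the image is still in 12 when the walk enters
    5, and the walk stays in 6 while the image passes from 13 to 14. *)
Lemma no_gaps4 A : nonrep_family k 19 A ->
  (forall i, i < 17 -> (s <= overlap A i i.+2) = (4 %| i)) -> False.
Proof.
move=> fA B.
have S i : i < 18 -> overlap A i i.+1 = 0 by apply: overlap_succ fA.
have S' i : i < 18 -> overlap A i.+1 i = 0 by apply: overlap_pred fA.
have d i : i < 16 -> odd i -> overlap A i i.+2 = 0.
  move=> i16 oi; have [i4 | i4] := boolP (4 %| i.+1).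
    by apply: (@overlap2_pred 19 A i fA); [lia | have := B i.+1; rewrite i4; lia].
  case: i => // i in i16 oi i4 *.
  by apply: (@overlap2_succ 19 A i fA); [lia | have := B i; lia].
have sep i : i < 3 -> [/\ overlap A (3 + i * 4) (6 + i * 4) = 0,
    overlap A (4 + i * 4) (7 + i * 4) = 0 & s <= overlap A (3 + i * 4) (7 + i * 4)].
  move=> i3; have fi : nonrep_family k 9 (fun j => A (j + (i * 4).+1)).
    by apply: (family_shift fA); lia.
  have Bi j : j < 7 ->
      (s <= overlap A (j + (i * 4).+1) (j + (i * 4).+1).+2) = (j == 3).
    by move=> j7; rewrite B; lia.
  have := separator fi.
  have := Bi 0 isT; have := Bi 1 isT; have := Bi 2 isT; have := Bi 3 isT.
  have := Bi 4 isT; have := Bi 5 isT; have := Bi 6 isT.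
  rewrite !addSn !addnS !add0n /= => b6 b5 b4 b3 b2 b1 b0.
  by apply; rewrite ?b3 // ltnNge ?b0 ?b1 ?b2 ?b4 ?b5 ?b6.
have [t3 t4 o3] := sep 0 isT; have [t7 t8 o7] := sep 1 isT.
have [t11 t12 o11] := sep 2 isT.
rewrite /= in t3 t4 o3 t7 t8 o7 t11 t12 o11.
have pos i j : s <= overlap A i j -> 0 < overlap A i j by lia.
have f4 : overlap A 4 8 = 0.
  by apply: (first_disjoint (family_shift fA (isT : 3 + 7 <= 19)));
    [exact: pos | exact: (d 5) | exact: (d 7)].
have f8 : overlap A 8 12 = 0.
  by apply: (first_disjoint (family_shift fA (isT : 7 + 7 <= 19)));
    [exact: pos | exact: (d 9) | exact: (d 11)].
have f12 : overlap A 12 16 = 0.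
  by apply: (first_disjoint (family_shift fA (isT : 11 + 7 <= 19)));
    [exact: pos | exact: (d 13) | exact: (d 15)].
have l6 : overlap A 6 10 = 0.
  by apply: (last_disjoint (family_shift fA (isT : 5 + 7 <= 19)));
    [exact: pos | exact: (d 5) | exact: (d 7)].
have l10 : overlap A 10 14 = 0.
  by apply: (last_disjoint (family_shift fA (isT : 9 + 7 <= 19)));
    [exact: pos | exact: (d 9) | exact: (d 11)].
have /overlap_pick[x [x3 x11]] := ltnW (@overlap_trans 19 A 3 7 11 fA isT o3 o7).
have /overlap_pick[x' [x'7 x'15]] :=
  ltnW (@overlap_trans 19 A 7 11 15 fA isT o7 o11).
have link p q j : p < 19 -> q < 19 -> j < 19 ->
    overlap A p j = 0 -> overlap A q j = 0 -> forall a b,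
    overlap A p a = 0 -> overlap A q b = 0 -> overlap A j a = 0 ->
    s <= overlap A a b -> 0 < overlap A p q.
  move=> pn qn jn pj qj a b pa qb ja ab.
  by have := overlap_link fA pn qn jn pj qj pa qb ja; lia.
have /overlap_pick[u [u4 u12]] : 0 < overlap A 4 12.
  by apply: (@link 4 12 8 _ _ _ f4 _ 7 11); rewrite // ?S' // overlapC.
have /overlap_pick[w [w6 w14]] : 0 < overlap A 6 14.
  by apply: (@link 6 14 10 _ _ _ l6 _ 7 11); rewrite // ?S ?S' // overlapC.
have /overlap_pick[u' [u'8 u'16]] : 0 < overlap A 8 16.
  by apply: (@link 8 16 12 _ _ _ f8 _ 11 15); rewrite // ?S ?S' // overlapC.
have two p q i j : p < 19 -> q < 18 -> overlap A p i = 0 ->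
    overlap A q j = 0 -> overlap A q.+1 j = 0 -> s <= overlap A i j ->
    1 < #|A p :&: (A q :|: A q.+1)|.
  move=> pn qn pi qj qj' ij.
  by have := overlap_two fA pn qn pi qj qj'; clear -ij sk; lia.
have c9 : 1 < #|A 9 :&: (A 16 :|: A 17)|.
  by apply: (@two 9 16 11 15); rewrite ?S' ?d // overlapC d.
have c10 : 1 < #|A 10 :&: (A 16 :|: A 17)|.
  by apply: (@two 10 16 11 15); rewrite ?S ?S' ?d // overlapC d.
have [b [v' [b_ v'9 v'b v'u]]] := two_pick u' c9.
have [b' [w' [b'_ w'10 w'b w'u]]] := two_pick u' c10.
have u'v' := overlap0_neq (S 8 isT) u'8 v'9.
have v'w' := overlap0_neq (S 9 isT) v'9 w'10.
rewrite eq_sym in w'u.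
have [/overlap_pick[v [v5 v13]] | o513] := boolP (0 < overlap A 5 13).
  apply: (no_repetition fA
    (r := [:: (3, 11, x); (4, 12, u); (5, 13, v); (6, 14, w); (7, 15, x');
      (8, 16, u'); (9, b, v'); (10, b', w')])) => //=.
  - rewrite /listed /= x3 x11 u4 u12 v5 v13 w6 w14 x'7 x'15 u'8 u'16.
    rewrite v'9 v'b w'10 w'b.
    by case: b_ => ->; case: b'_ => ->.
  - by case: b_ => ->; case: b'_ => ->.
  - by case: b_ => ->; case: b'_ => ->; rewrite /= ?u'v' ?v'w' ?w'u.
have no13 y : y \in A 5 -> y \in A 13 -> False.
  move=> y5 y13; move/negP: o513; apply; apply/card_gt0P.
  by exists y; rewrite inE y5.
have /(two_pick u)[e [v [e_ v5 ve _]]] : 1 < #|A 5 :&: (A 12 :|: A 13)|.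
  by apply: (@two 5 12 7 11); rewrite ?S' ?d // overlapC d.
have /(two_pick u)[e' [y [e'_ y13 ye _]]] : 1 < #|A 13 :&: (A 5 :|: A 6)|.
  by apply: (@two 13 5 11 7); rewrite ?S ?d // 1?(overlapC A 13) ?d // overlapC.
have v12 : v \in A 12 by case: e_ ve => -> // /(no13 _ v5).
have y6 : y \in A 6 by case: e'_ ye => -> // /no13 /(_ y13).
have uv := overlap0_neq (S 4 isT) u4 v5.
have yw := overlap0_neq (S 13 isT) y13 w14.
apply: (no_repetition fA
  (r := [:: (3, 11, x); (4, 12, u); (5, 12, v); (6, 13, y); (6, 14, w);
    (7, 15, x'); (8, 16, u'); (9, b, v'); (10, b', w')])) => //=.
- rewrite /listed /= x3 x11 u4 u12 v5 v12 y6 y13 w6 w14 x'7 x'15 u'8 u'16.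
  rewrite v'9 v'b w'10 w'b.
  by case: b_ => ->; case: b'_ => ->.
- by case: b_ => ->; case: b'_ => ->.
- by case: b_ => ->; case: b'_ => ->; rewrite /= ?u'v' ?v'w' ?w'u ?uv ?yw.
Qed.

(** By [no_gap2] and [no_gap3] a heavy position is followed by one exactly four steps
    later.  The first one at or after 3 is at most 6, which leaves room on both
    sides for the short repetitions and for the 19 copies of [no_gaps4]. *)
Lemma no_nonrep_family28 A : ~ nonrep_family k 28 A.
Proof.
move=> fA.
pose B i := s <= overlap A i i.+2.
have Bs1 i : i < 25 -> B i -> ~~ B i.+1.
  by move=> ib; have := @overlap2_succ 28 A i fA; rewrite /B; lia.
have Bs2 i : i < 22 -> B i.+1 -> ~~ B i.+3.
  move=> ib; rewrite /B -ltnNge; apply: (no_gap2 (family_shift fA _)); lia.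
have Bs3 i : i < 19 -> ~~ B i -> B i.+2 -> B i.+2.+3 -> B i.+4.+3.
  move=> ib; rewrite /B -ltnNge => b0 b2 b5; rewrite leqNgt; apply/negP => b7.
  by apply: (no_gap3 (family_shift fA (_ : i + 10 <= 28))) b0 b2 b5 b7; lia.
have per i : 3 <= i < 20 -> B i -> [/\ ~~ B i.+1, ~~ B i.+2, ~~ B i.+3 & B i.+4].
  case: i => [|[|[|i]]] // ib Bi.
  have n1 : ~~ B i.+4 by apply: Bs1 => //; lia.
  have n2 : ~~ B i.+4.+1 by apply: Bs2 => //; lia.
  have n3 : ~~ B i.+4.+2.
    apply/negP => Bi3; have := @Bs2 i.+4.+1; rewrite Bi3 (@Bs3 i.+1) //; try lia.
    by apply/negP => Bi1; have := @Bs2 i; rewrite Bi1 Bi; lia.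
  split=> //; have := @heavy_within_four 28 A i.+4 fA; rewrite -!/(B _).
  by rewrite (negbTE n1) (negbTE n2) (negbTE n3); apply; lia.
have [p [p3 p6 Bp]] : exists p, [/\ 3 <= p, p <= 6 & B p].
  by case/or4P: (@heavy_within_four 28 A 3 fA isT) => Bp;
    [exists 3 | exists 4 | exists 5 | exists 6].
have per' j : j < 4 -> B (j * 4 + p) ->
    [/\ ~~ B (j * 4 + p).+1, ~~ B (j * 4 + p).+2,
        ~~ B (j * 4 + p).+3 & B (j * 4 + p).+4].
  by move=> j4; apply: per; clear -j4 p3 p6; lia.
have [a1 a2 a3 a4] := per' 0 isT Bp.
have [b1 b2 b3 b4] := per' 1 isT a4.
have [c1 c2 c3 c4] := per' 2 isT b4.
have [e1 e2 e3 e4] := per' 3 isT c4.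
apply: (no_gaps4 (family_shift fA (_ : p + 19 <= 28))) => [|i].
  by clear -p6; lia.
do 17?[case: i => [_|i]; first by first [exact: negbTE | assumption]].
by [].
Qed.

End Overlaps.

(** * The bounds *)

Lemma nonrepetitive_proper (V : finType) (e : rel V) (C : Type) (c : V -> C) u v :
  nonrepetitive e c -> e u v -> u != v -> c u <> c v.
Proof.
move=> nr uv nuv cuv; apply: (nr [:: u; v]).
  by rewrite /is_path /= uv mem_seq1 nuv.
by exists 1; split=> //= -[|//] _; rewrite /= cuv.
Qed.

(** The paths over the sets [A i] are turned into paths of the product by choosing,
    for a colour of [A i], the vertex of copy [i] that has this colour; it is unique
    since the copies are complete graphs. *)
Lemma colorable_lower n k m : 28 <= n ->
  nonrep_colorable (lex_product (@path_graph n) (@complete_graph k)) m ->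
  3 * k + k %/ 2 <= m.
Proof.
move=> n28 [c nrc]; rewrite leqNgt; apply/negP => mk.
have k0 : 0 < k by lia.
have n0 : 0 < n by lia.
pose g i : 'I_n := insubd (Ordinal n0) i.
have gE i : i < 28 -> g i = i :> nat.
  by move=> i28; rewrite val_insubd (leq_trans i28 n28).
pose A i : {set 'I_m} := [set c (g i, j) | j : 'I_k].
pose s := (k - k %/ 2).+1.
apply: (@no_nonrep_family28 'I_m k s _ _ A); rewrite ?card_ord /s; try lia.
split=> [i i28 | r r0 lr nr ur].
  rewrite card_imset ?card_ord // => j j' cjj'; apply/eqP/idP/negPn/negP => njj'.
  apply: (nonrepetitive_proper nrc _ _ cjj').
    by rewrite /lex_product /complete_graph /= eqxx njj' orbT.
  by rewrite xpair_eqE eqxx.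
pose v (u : nat * 'I_m) : 'I_n * 'I_k :=
  (g u.1, odflt (Ordinal k0) [pick j | c (g u.1, j) == u.2]).
have cv u : listed 28 A u -> c (v u) = u.2.
  case: u => p x /andP[/= p28 /imsetP[j _ xE]]; rewrite /v /=.
  by case: pickP => [j' /eqP// | /(_ j)]; rewrite xE eqxx.
have v_inj : {in listed 28 A &, injective v}.
  move=> [p x] [q y] px qy /= vE.
  have := cv _ px; rewrite vE (cv _ qy) /= => ->.
  move/andP: px => [/= p28 _]; move/andP: qy => [/= q28 _].
  by case: vE => /(congr1 val) /=; rewrite !gE // => ->.
have vadj t t' : listed 28 A t -> listed 28 A t' -> t != t' -> near t t' ->
    lex_product (@path_graph n) (@complete_graph k) (v t) (v t').
  case: t t' => p x [q y] /= px qy nxy pq; apply/orP.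
  have /andP[/= p28 _] := px; have /andP[/= q28 _] := qy.
  have [epq | npq] := eqVneq p q.
    right; rewrite -epq eqxx /=; apply: contra nxy => /eqP h.
    by apply/eqP/v_inj => //; rewrite /v /= -epq h.
  by left; rewrite /path_graph /= !gE //; move: pq; rewrite /near /close /=; lia.
have Vadj : sorted (lex_product (@path_graph n) (@complete_graph k))
    (map v (halves r)).
  case: r r0 lr nr ur => // a r _; set h := halves _ => lr nr ur.
  pose t0 := head (0, c (g 0, Ordinal k0)) h.
  apply/(sortedP (v t0)) => i; rewrite size_map => ih.
  rewrite !(nth_map t0) ?(ltnW ih) //; apply: vadj.
  - by apply/(allP lr)/mem_nth/ltnW.
  - by apply/(allP lr)/mem_nth.
  - by rewrite nth_uniq ?(ltnW ih) //; lia.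
  - by have /(sortedP t0)/(_ _ ih) := nr.
apply: (nrc (map v (halves r))).
  rewrite /is_path Vadj map_inj_in_uniq // => t t' /(allP lr) lt /(allP lr) lt'.
  exact: v_inj.
have -> : map c (map v (halves r)) = map snd r ++ map snd r.
  have -> : map c (map v (halves r)) = map snd (halves r).
    by rewrite -map_comp; apply/eq_in_map => t /(allP lr); exact: cv.
  by rewrite /halves map_cat -!map_comp.
exists (size r); split; first by rewrite lt0n size_eq0.
  by rewrite size_cat !size_map addnn.
by move=> i ir; rewrite !onth_cat size_map ir ltnNge leq_addr /= addKn.
Qed.

Theorem theorem1p4 (n k : nat) (hn : 28 <= n) (hk : 1 <= k) :
  3 * k + k %/ 2
    <= thue_chromatic (lex_product (@path_graph n) (@complete_graph k))
    <= 4 * k.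
Proof.
apply/andP; split; last exact/thue_chromatic_min/colorable_4k.
exact: colorable_lower hn (thue_chromatic_colorable _).
Qed.
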